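(* For almost all positive integers $n$ (that is, for a set of positive integers $n$ of natural density $1$), the number $E_1(n)$ of sporadic Reinhardt polygons with $n$ sides exceeds the number $E_0(n)$ of periodic Reinhardt polygons with $n$ sides.
   Context: A Reinhardt polygon is an equilateral convex polygon $P$ that may be inscribed in a Reuleaux polygon $R$ in such a way that every vertex of $R$ is a vertex of $P$. The line segments joining vertices of a Reinhardt $n$-gon at maximal distance from one another contain a star polygon whose angles have measures $k_i\pi/n$ with $k_i$ positive integers summing to $n$; listing these in the order of visitation along the star polygon gives a composition $[k_1,\ldots,k_\ell]$ of $n$ into an odd number $\ell$ of parts. Polygons are identified when one is obtained from the other by rotations and flips, so a Reinhardt $n$-gon is identified with the equivalence class of such a composition under the dihedral action (cyclic shifts and reversal of the parts); such a class is called a dihedral composition. Equivalently (Reinhardt's correspondence), a Reinhardt polynomial for $n$ is a polynomial $F(z)$ with $\deg F<n$, all coefficients in $\{-1,0,1\}$, nonzero coefficients alternating in sign, an odd number of nonzero coefficients, and divisible by the cyclotomic polynomial $\Phi_{2n}(z)$. A Reinhardt polynomial $F(z)=\pm\sum_{i=0}^{\ell}(-1)^i z^{k_i}$ with $k_0<k_1<\cdots<k_\ell$ corresponds to the dihedral composition $[k_1-k_0,k_2-k_1,\ldots,k_\ell-k_{\ell-1},n-k_\ell+k_0]$ of $n$. The Reinhardt polygons with $n$ sides (up to equivalence) are exactly the dihedral compositions of $n$ arising in this way. A Reinhardt $n$-gon is periodic if its composition consists of a composition of some divisor $m<n$ of $n$ into an odd number of parts, repeated $n/m$ times. It is sporadic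 if it is not periodic. $E_0(n)$ and $E_1(n)$ denote the numbers of periodic and sporadic Reinhardt polygons with $n$ sides, respectively, counted as dihedral equivalence classes. *)

(* Defs.v *)
From HB Require Import structures.
From mathcomp Require Import all_boot all_order all_algebra all_field.
From mathcomp Require Import all_classical all_reals all_analysis.

Set Implicit Arguments.
Unset Strict Implicit.
Unset Printing Implicit Defensive.

Import Order.TTheory GRing.Theory Num.Theory.
Import numFieldNormedType.Exports.

Local Open Scope classical_set_scope.
Local Open Scope ring_scope.

Definition nonzero_coefs (F : {poly int}) : seq int := [seq a <- F | a != 0].

(* [%|] on {poly int} is pseudo-divisibility (up to a nonzero integer factor);
   as 'Phi_(2 * n) is monic, it is here divisibility in {poly int}. *)
Definition reinhardt_poly (n : nat) (F : {poly int}) : bool :=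
  [&& (size F <= n)%N,
      all [in [:: -1; 0; 1]] F,
      sorted (fun a b => b == - a) (nonzero_coefs F),
      odd (size (nonzero_coefs F))
    & 'Phi_(2 * n) %| F].

Definition exponents (F : {poly int}) : seq nat :=
  [seq i <- iota 0 (size F) | F`_i != 0].

(* For exponents k_0 < ... < k_l, the last part n - k_l + k_0 is obtained as
   the difference between n + k_0 and k_l. *)
Definition poly_composition (n : nat) (F : {poly int}) : seq nat :=
  if exponents F is k0 :: ks
  then pairmap (fun a b => b - a)%N k0 (rcons ks (n + k0)%N)
  else [::].

Definition is_composition (n : nat) (c : seq nat) : bool :=
  all (leq 1) c && (sumn c == n).

(* A finite type with room for every composition of n: such a composition has
   at most n parts, each of them at most n. *)
Definition bounded_seq (n : nat) : finType := {bseq n of 'I_n.+1}.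

Definition parts (n : nat) (c : bounded_seq n) : seq nat :=
  [seq val k | k <- val c].

Definition reinhardt_composition (n : nat) (c : seq nat) : Prop :=
  exists2 F, reinhardt_poly n F & poly_composition n F = c.

Definition dihedral_eq (c d : seq nat) : Prop :=
  exists i, d = rot i c \/ d = rot i (rev c).

Definition dihedral_class (n : nat) (c : bounded_seq n) :
    {set bounded_seq n} :=
  [set d | `[< dihedral_eq (parts c) (parts d) >]].

Definition reinhardt_polygons (n : nat) : {set {set bounded_seq n}} :=
  [set dihedral_class c | c : bounded_seq n
                        & `[< reinhardt_composition n (parts c) >]].

Definition periodic_composition (n : nat) (c : seq nat) : Prop :=
  exists m d, [/\ (m %| n)%N, (m < n)%N, is_composition m d, odd (size d)
                & c = flatten (nseq (n %/ m) d)].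

Definition periodic (n : nat) (P : {set bounded_seq n}) : bool :=
  [exists c in P, `[< periodic_composition n (parts c) >]].

Definition sporadic (n : nat) (P : {set bounded_seq n}) : bool :=
  ~~ periodic P.

Definition E0 (n : nat) : nat := #|[set P in reinhardt_polygons n | periodic P]|.

Definition E1 (n : nat) : nat := #|[set P in reinhardt_polygons n | sporadic P]|.

Definition has_natural_density (R : realType) (A : pred nat) (d : R) : Prop :=
  (fun N : nat => (count A (iota 1 N))%:R / N%:R : R) @ \oo --> d.

(* Main.v *)
Require Import Defs.
From HB Require Import structures.
From mathcomp Require Import all_boot all_order all_algebra all_field.
From mathcomp Require Import all_classical all_reals all_analysis.
From mathcomp Require Import cyclic zify ring.

(** Reinhardt polygons correspond to binary sequences [b] on the integers with
    [b (i + n) = ~~ b i]. A Reinhardt polynomial has nonzero coefficients of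
    alternating sign, so it is the sequence of differences [b (i + 1) - b i] of
    such a [b], and it vanishes at a primitive [2n]-th root of unity [z] exactly
    when the sum of [(-1) ^ b i * z ^ i] over one window of length [n] does
    ([reinhardt_diff_poly]). The alternation condition has thus disappeared,
    and the remaining one is linear.

    Write [n = p * q * r] with odd primes [p < q], [p] the least odd prime
    factor of [n]. The window splits into the [r] residue classes modulo [r],
    and the sum over one class already vanishes if the restriction of [b] to
    that class changes to its complement under translation by [n / p], or under
    translation by [n / q] ([reinhardt_class_periodic]). The choice between the
    two can be made independently for each class. In the first case [2 ^ q]
    restrictions are available; allowing just one further restriction, of the
    second kind, gives at least [(2 ^ q + 1) ^ r] sequences ([mixed]). Passing
    to polygons loses at most a factor [4 * n ^ 2]: a choice of starting
    position and sign to recover [b] from the composition, and a choice of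
    rotation and reflection for the dihedral class ([card_le_reinhardt]).

    A periodic polygon repeats a composition of some [m] an odd number
    [n / m > 1] of times, so [m <= n / p = q * r], and there are at most
    [2 ^ (q * r + 1)] of them ([E0_le]). For bounded [p] and [q] the ratio
    [(1 + 2 ^ - q) ^ r] grows exponentially in [n], hence beats [n ^ 2], and
    sporadic polygons prevail ([sporadic_dominate]).

    It remains to see that almost every [n] has two distinct odd prime factors
    below a bound depending only on the density to be discarded. There are
    coprime odd moduli [M1] and [M2] for which the proportion of integers
    coprime to either one is as small as desired ([exists_small_totient]); any
    [n] coprime to neither has an odd prime factor in common with each. *)

Set Implicit Arguments.
Unset Strict Implicit.
Unset Printing Implicit Defensive.

Import Order.TTheory GRing.Theory Num.Theory.
Import numFieldNormedType.Exports.

Local Open Scope ring_scope.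

(** * Almost every integer has two small odd prime factors *)

Lemma sum_coprime_blocks (M a : nat) :
  (\sum_(0 <= x < a * M) coprime M x = a * totient M)%N.
Proof.
elim: a => [|a IHa]; first by rewrite !mul0n big_geq.
rewrite mulSn addnC (big_cat_nat (leq0n _) (leq_addr _ _)) /= IHa mulSn addnC.
congr (_ + _)%N; rewrite totient_count_coprime addnC.
rewrite -{1}(add0n (a * M)%N) big_addn addnK.
by apply: eq_bigr => i _; rewrite addnC -coprime_modr modnMDl coprime_modr.
Qed.

Lemma totientM_le (d e : nat) : (totient (d * e) <= d * totient e)%N.
Proof.
rewrite totient_count_coprime -sum_coprime_blocks; apply: leq_sum => i _.
by rewrite coprimeMl; case: (coprime d i).
Qed.

Lemma count_coprime_le (M N : nat) : (0 < M)%N ->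
  (count (coprime M) (iota 1 N) <= (N %/ M).+2 * totient M)%N.
Proof.
move=> M0; rewrite -sum1_count big_mkcond /=.
apply: (@leq_trans (\sum_(0 <= x < (N %/ M).+2 * M) coprime M x)); last first.
  by rewrite sum_coprime_blocks.
have le1 : (N.+1 <= (N %/ M).+2 * M)%N.
  rewrite {1}(divn_eq N M) -addnS -addn2 mulnDl leq_add2l mul2n -addnn.
  by rewrite (leq_trans (ltn_pmod N M0)) ?leq_addr.
rewrite (big_cat_nat (leq0n _) le1) /= (leq_trans _ (leq_addr _ _)) //.
rewrite [leqRHS]big_ltn //; apply: leq_trans (leq_addl _ _).
rewrite /index_iota subn1 /=; apply: leq_sum => i _; by case: coprime.
Qed.

Lemma harmonic_unbounded (R : realType) (C : nat) :
  exists K, C%:R <= \sum_(0 <= j < K) (j.+1%:R^-1 : R).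
Proof.
have nd : {homo (series (harmonic : R^nat)) : n m / (n <= m)%N >-> n <= m}.
  apply/nondecreasing_seqP => n; rewrite /series /= big_nat_recr //= lerDl.
  by rewrite invr_ge0.
have /cvgryPge/(_ C%:R) [K _ HK] := nondecreasing_dvgn_lt nd (@dvg_harmonic R).
exists K; exact: (HK K (leqnn K)).
Qed.

(** The numbers [M / d] are distinct divisors of [M], and the totients of all
    divisors of [M] add up to [M]. *)
Lemma sum_totient_quot (M : nat) (s : seq nat) : (0 < M)%N -> uniq s ->
  all (fun d => d %| M)%N s -> (\sum_(d <- s) totient (M %/ d) <= M)%N.
Proof.
move=> M0 us ds.
have inj : {in s &, injective (fun d => M %/ d)%N}.
  move=> d e /(allP ds) dM /(allP ds) eM /= Hde.
  have := divnK dM; rewrite Hde -{2}(divnK eM) => /eqP.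
  rewrite eqn_mul2l => /orP[|/eqP //].
  have e0 := dvdn_gt0 M0 eM.
  by rewrite eqn0Ngt divn_gt0 // (dvdn_leq M0 eM).
rewrite -[leqRHS]sum_totient_dvd -(big_mkord (fun d => d %| M)%N totient).
rewrite -(big_map (fun d => M %/ d)%N xpredT totient) -[leqRHS]big_filter.
apply: uniq_sub_le_big => //.
- by move=> x y; exact: leq_addr.
- by rewrite map_inj_in_uniq.
- by rewrite filter_uniq ?iota_uniq.
move=> _ /mapP[d /(allP ds) dM ->].
rewrite mem_filter mem_index_iota /= ltnS leq_div andbT.
by apply/dvdnP; exists d; rewrite mulnC divnK.
Qed.

(** Take [M] to be the product of the numbers [1 + j * A] for [1 <= j <= K]; they
    are coprime to [A] and divide [M]. Since
    [M >= \sum_d totient (M / d) >= totient M * \sum_d 1 / d] over these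
    divisors [d], and [\sum_j 1 / (1 + j * A)] diverges like the harmonic
    series, [M / totient M] is unbounded. *)
Lemma exists_small_totient (R : realType) (A C : nat) : (0 < A)%N ->
  exists M, [/\ (0 < M)%N, coprime M A & (C * totient M <= M)%N].
Proof.
move=> A0; have [K HK] := harmonic_unbounded R (C * A.+1).
pose d j := (j.+1 * A).+1; pose s := [seq d j | j <- iota 0 K].
pose M := (\prod_(e <- s) e)%N.
have M0 : (0 < M)%N by rewrite /M big_map prodn_gt0.
have us : uniq s.
  rewrite map_inj_uniq ?iota_uniq // => i j [] /eqP.
  by rewrite eqn_add2l eqn_mul2r (gtn_eqF A0) => /eqP.
have ds : all (fun e => e %| M)%N s.
  by apply/allP => e es; rewrite /M (big_rem e) //= dvdn_mulr.
exists M; split => //.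
  rewrite /M big_map; elim/big_ind: _ => //=.
  - exact: coprime1n.
  - by move=> x y; rewrite coprimeMl => -> ->.
  - by move=> j _; rewrite /d -add1n coprime_sym /coprime addnC gcdnMDl gcdn1.
have := sum_totient_quot M0 us ds; rewrite -(ler_nat R) natr_sum => le1.
rewrite -(ler_nat R); apply: le_trans le1; rewrite natrM.
have A1 : 0 < A.+1%:R :> R by rewrite ltr0n.
apply: (@le_trans _ _ (\sum_(e <- s) (totient M)%:R / e%:R)); last first.
  rewrite !big_seq; apply: ler_sum => e es.
  have eM := allP ds _ es; have e0 := dvdn_gt0 M0 eM.
  rewrite ler_pdivrMr ?ltr0n // -natrM ler_nat -{1}(divnK eM) mulnC.
  by rewrite (mulnC (totient _)) totientM_le.
rewrite -mulr_sumr mulrC ler_wpM2l //.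
rewrite /s big_map -(ler_pM2r A1) -natrM (le_trans HK) // mulr_suml.
rewrite /index_iota subn0; apply: ler_sum => j _.
rewrite ler_pdivlMl ?ltr0n // ler_pdivrMr ?ltr0n // -natrM ler_nat mulnC.
by rewrite /d mulnS -addn1 addnC leq_add2r.
Qed.

(** The least odd prime factor of [n] governs the number of periodic polygons,
    hence the minimality of [p]. *)
Definition two_small_odd_primes (K n p q : nat) : Prop :=
  [/\ [&& prime p, odd p & p %| n], [&& prime q, odd q & q %| n],
      (p < q <= K)%N &
      forall p', prime p' -> odd p' -> p' %| n -> (p <= p')%N]%N.

Lemma common_odd_prime (M n : nat) : coprime M 2 -> (0 < M)%N -> ~~ coprime M n ->
  exists p, [/\ prime p, odd p, (p %| M)%N, (p %| n)%N & (p <= M)%N].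
Proof.
move=> M2 M0 nc; have g1 : (1 < gcdn M n)%N.
  by rewrite ltn_neqAle eq_sym nc gcdn_gt0 M0.
have gM := dvdn_trans (pdiv_dvd _) (dvdn_gcdl M n).
exists (pdiv (gcdn M n)); split => //; first exact: pdiv_prime.
- have := coprime_dvdl gM M2; rewrite coprimen2 //.
- exact: dvdn_trans (pdiv_dvd _) (dvdn_gcdr M n).
- exact: dvdn_leq.
Qed.

(** The two common factors differ because [M1] and [M2] are coprime. The least
    odd prime factor of [n] is at most the first of them and can be paired with
    one of the two. *)
Lemma two_small_odd_primesP (M1 M2 n : nat) : (0 < M1)%N -> (0 < M2)%N ->
  coprime M1 2 -> coprime M2 (2 * M1) -> ~~ coprime M1 n -> ~~ coprime M2 n ->
  exists p q, two_small_odd_primes (M1 + M2) n p q.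
Proof.
move=> M10 M20 M1o; rewrite coprimeMr => /andP[M2o M12] n1 n2.
have [p1 [p1p p1o p1M p1n p1le]] := common_odd_prime M1o M10 n1.
have [p2 [p2p p2o p2M p2n p2le]] := common_odd_prime M2o M20 n2.
have p12 : p1 != p2.
  apply: contraTneq M12 => p12; rewrite -p12 in p2M.
  apply: contraL (prime_gt1 p1p) => M12.
  by rewrite -leqNgt dvdn_leq // -(eqP M12) dvdn_gcd p2M.
have exp : exists p, [&& prime p, odd p & (p %| n)%N].
  by exists p1; rewrite p1p p1o.
case: (ex_minnP exp) => p pP pmin; exists p.
have {}pmin p' : prime p' -> odd p' -> (p' %| n)%N -> (p <= p')%N.
  by move=> *; apply: pmin; apply/and3P.
have [pp1|pp1] := eqVneq p p1; [exists p2 | exists p1]; split => //.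
- exact/and3P.
- by rewrite ltn_neqAle pp1 p12 -pp1 pmin //= (leq_trans p2le) ?leq_addl.
- exact/and3P.
- by rewrite ltn_neqAle pp1 pmin //= (leq_trans p1le) ?leq_addr.
Qed.

(** The bound [K] depends on the tolerated proportion [2 / C] of exceptions only,
    so the threshold [n0] may afterwards be chosen in terms of [K]. *)
Lemma few_exceptions (R : realType) (C : nat) : exists K, forall (A : pred nat) n0,
    (forall n, (n0 <= n)%N -> (exists p q, two_small_odd_primes K n p q) -> A n) ->
  exists B, forall N, (C * count (predC A) (iota 1 N) <= 2 * N + B)%N.
Proof.
have [M1 [M10 M1o M1C]] := @exists_small_totient R 2 C isT.
have [M2 [M20 M2o M2C]] : exists M, [/\ (0 < M)%N, coprime M (2 * M1)
    & (C * totient M <= M)%N].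
  by apply: exists_small_totient R _ _ _; rewrite muln_gt0.
exists (M1 + M2)%N => A n0 An; exists (C * n0 + 2 * M1 + 2 * M2)%N => N.
have bound M : (0 < M)%N -> (C * totient M <= M)%N ->
    (C * count (coprime M) (iota 1 N) <= N + 2 * M)%N.
  move=> M0 MC; apply: leq_trans (leq_mul (leqnn C) (count_coprime_le N M0)) _.
  rewrite mulnCA; apply: leq_trans (leq_mul (leqnn _) MC) _.
  by rewrite -addn2 mulnDl leq_add2r leq_divM.
apply: (@leq_trans (C * (count (fun n => n < n0)%N (iota 1 N) +
   (count (coprime M1) (iota 1 N) + count (coprime M2) (iota 1 N))))).
  rewrite leq_mul2l; apply/orP; right.
  elim: (iota 1 N) => //= n s IHs.
  have : (~~ A n <= (n < n0) + (coprime M1 n + coprime M2 n))%N.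
    case: (ltnP n n0) => /= n0n; first by case: (A n).
    case c1 : (coprime M1 n) => //; first by case: (A n).
    case c2 : (coprime M2 n) => //; first by case: (A n).
    by rewrite An //; apply: two_small_odd_primesP; rewrite ?c1 ?c2.
  by lia.
have : (count (fun n => n < n0)%N (iota 1 N) <= n0)%N.
  rewrite -size_filter -[leqRHS](size_iota 0); apply: uniq_leq_size.
    by rewrite filter_uniq ?iota_uniq.
  by move=> n; rewrite mem_filter !mem_iota /= add0n => /andP[].
move=> /(leq_mul (leqnn C)).
have := bound _ M10 M1C; have := bound _ M20 M2C.
by rewrite !mulnDr; lia.
Qed.

(** As [C] is arbitrary in [few_exceptions], the proportion of exceptions tends
    to 0. *)
Lemma density_one (R : realType) (A : pred nat) :
  (forall K, exists n0, forall n, (n0 <= n)%N ->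
    (exists p q, two_small_odd_primes K n p q) -> A n) ->
  has_natural_density A (1 : R).
Proof.
move=> HA; rewrite /has_natural_density; apply/cvgrPdist_le => e e0.
have [C HC] : exists C : nat, 3 / e <= C.+1%:R.
  have /ltW := archi_boundP (ltW (divr_gt0 (ltr0n R 3) e0) ).
  by move=> h; exists (Num.bound (3 / e)); apply: le_trans h _; rewrite ler_nat.
have [K HK] := few_exceptions R C.+1.
have [n0 Hn0] := HA K; have [B HB] := HK A n0 Hn0.
exists B.+1 => // N /= BN.
have N0 : 0 < N%:R :> R by rewrite ltr0n (leq_trans _ BN).
have cA : (count A (iota 1 N))%:R = N%:R - (count (predC A) (iota 1 N))%:R :> R.
  by apply/eqP; rewrite eq_sym subr_eq -natrD count_predC size_iota.
rewrite cA mulrBl divff ?gt_eqF // opprB addrC subrK ger0_norm ?divr_ge0 ?ler0n //.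
rewrite ler_pdivrMr //.
have {HB} : C.+1%:R * (count (predC A) (iota 1 N))%:R <= 3 * N%:R :> R.
  by rewrite -!natrM ler_nat; have := HB N; lia.
set x := _%:R => h; rewrite -(ler_pM2l (_ : 0 < C.+1%:R)) ?ltr0n // (le_trans h) //.
rewrite mulrA ler_pM2r // -ler_pdivrMr //.
Qed.

(** * Exponential growth against a square *)

Lemma expn_succ_ge (Q m : nat) : (Q ^ m + m * Q ^ m.-1 <= Q.+1 ^ m)%N.
Proof.
elim: m => // -[_|m IHm]; first by rewrite /= mul1n expn1 expn0 addn1.
rewrite expnS; apply: leq_trans (leq_mul (leqnn _) IHm).
by rewrite /= !expnS; nia.
Qed.

(** Each block of [Q] factors [(Q + 1) / Q] contributes at least 2, by
    Bernoulli's inequality. *)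
Lemma expn_succ_double (Q k r : nat) : (0 < Q)%N -> (k * Q <= r)%N ->
  (2 ^ k * Q ^ r <= Q.+1 ^ r)%N.
Proof.
move=> Q0 kr; have le_exp m1 m2 e : (m1 <= m2 -> m1 ^ e <= m2 ^ e)%N.
  by case: e => // e; rewrite leq_exp2r.
rewrite -(subnKC kr) !expnD mulnA leq_mul ?le_exp //.
rewrite ![(k * Q)%N]mulnC !expnM -expnMn le_exp //.
by apply: leq_trans (expn_succ_ge Q Q); rewrite -expnS prednK // addnn mul2n.
Qed.

(** With [k] about [r / (4 * 2 ^ q)], the quotient of the two powers is at least
    [2 ^ (4 * k) >= (k + 1) ^ 4], whereas [n ^ 2] is only quadratic in [k + 1]. *)
Lemma mixed_count_dominates (K : nat) : exists n0, forall n p q r,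
    (n0 <= n)%N -> n = (p * q * r)%N -> (p < q <= K)%N ->
  (16 * n ^ 2 * 2 ^ (q * r) < (2 ^ q).+1 ^ r)%N.
Proof.
(* [D] is chosen so that [n <= D * (k + 1)]. *)
pose D := (4 * K ^ 2 * 2 ^ K)%N.
exists (4 * D ^ 2 + 1)%N => n p q r nD npqr /andP[pq qK].
have Q0 : (0 < 2 ^ q)%N by rewrite expn_gt0.
have QK : (2 ^ q <= 2 ^ K)%N by rewrite leq_exp2l.
pose k := (r %/ (4 * 2 ^ q))%N.
have rk : (r < k.+1 * (4 * 2 ^ q))%N by rewrite ltn_ceil // muln_gt0.
have kr : (4 * k * 2 ^ q <= r)%N by rewrite mulnAC mulnC leq_divM.
have nk : (n <= D * k.+1)%N.
  have -> : (D * k.+1 = K ^ 2 * (k.+1 * (4 * 2 ^ K)))%N by rewrite /D; ring.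
  rewrite npqr leq_mul //; first by rewrite -mulnn leq_mul // ltnW // (leq_trans pq).
  by apply: leq_trans (ltnW rk) _; rewrite !leq_mul.
have Dk : (4 * D < k.+1)%N.
  have D0 : (0 < D)%N by rewrite lt0n; apply: contraTneq nk => ->; lia.
  by rewrite -(ltn_pmul2l D0); move: nD nk; nia.
rewrite expnM; apply: leq_trans (expn_succ_double Q0 kr).
rewrite ltn_pmul2r ?expn_gt0 ?Q0 //.
have k2 : (k.+1 ^ 4 <= 2 ^ (4 * k))%N by rewrite mulnC expnM leq_exp2r // ltn_expl.
apply: leq_trans k2.
have nk2 : (n ^ 2 <= (D * k.+1) ^ 2)%N by rewrite leq_exp2r.
apply: (@leq_ltn_trans (16 * (D * k.+1) ^ 2)); first by rewrite leq_mul2l nk2 orbT.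
have -> : (16 * (D * k.+1) ^ 2 = (4 * D) ^ 2 * k.+1 ^ 2)%N by ring.
by rewrite (expnD _ 2 2) ltn_pmul2r ?expn_gt0 // ltn_exp2r.
Qed.


(** * Dihedral classes of compositions *)

Lemma dihedral_eq_refl (c : seq nat) : dihedral_eq c c.
Proof. by exists 0%N; left; rewrite rot0. Qed.

Lemma dihedral_eq_sym (c d : seq nat) : dihedral_eq c d -> dihedral_eq d c.
Proof.
case=> i [] ->; first by exists (size (rot i c) - i)%N; left; rewrite -/(rotr i _) rotK.
by exists i; right; rewrite -rev_rotr rotK revK.
Qed.

Lemma rot_rot_ex (T : Type) (i j : nat) (s : seq T) :
  exists k, rot j (rot i s) = rot k s.
Proof.
case: (leqP i (size s)) => [is_ | /ltnW /rot_oversize ->]; last by exists j.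
case: (leqP j (size s)) => [js | sj]; first by rewrite rot_add_mod //; eexists.
by exists i; rewrite rot_oversize // size_rot ltnW.
Qed.

Lemma dihedral_eq_trans (d c e : seq nat) :
  dihedral_eq c d -> dihedral_eq d e -> dihedral_eq c e.
Proof.
case=> i [] -> [j [] ->]; rewrite ?rev_rot ?revK /rotr.
- by have [k ->] := rot_rot_ex i j c; exists k; left.
- by have [k ->] := rot_rot_ex (size (rev c) - i) j (rev c); exists k; right.
- by have [k ->] := rot_rot_ex i j (rev c); exists k; right.
- by have [k ->] := rot_rot_ex (size c - i) j c; exists k; left.
Qed.

Lemma dihedral_eq_size (c d : seq nat) : dihedral_eq c d -> size c = size d.
Proof. by case=> i [] ->; rewrite size_rot ?size_rev. Qed.

(** Rotating by the length of the list or more changes nothing, so [2 * n] pairs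
    of a rotation and a reflection suffice. *)
Lemma dihedral_eq_bounded (n : nat) (c d : seq nat) : (0 < n)%N -> (size c <= n)%N ->
  dihedral_eq c d -> exists (i : 'I_n) (e : bool), d = rot i (if e then rev c else c).
Proof.
move=> n0 cn [i cd].
have [e {cd}cd] : exists e : bool, d = rot i (if e then rev c else c).
  by case: cd; [exists false | exists true].
case: (ltnP i n) => [i_n | ni]; first by exists (Ordinal i_n), e.
exists (Ordinal n0), e; rewrite cd rot0 rot_oversize // (leq_trans _ ni) //.
by case: (e); rewrite ?size_rev.
Qed.

Lemma mem_dihedral_class (n : nat) (c d : bounded_seq n) :
  d \in dihedral_class c <-> dihedral_eq (parts c) (parts d).
Proof. by rewrite inE; split=> /asboolP. Qed.

Lemma dihedral_class_eq (n : nat) (c d : bounded_seq n) :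
  dihedral_eq (parts c) (parts d) -> dihedral_class c = dihedral_class d.
Proof.
move=> cd; apply/setP => e; apply/idP/idP => /mem_dihedral_class h;
  apply/mem_dihedral_class; apply: dihedral_eq_trans h => //.
exact: dihedral_eq_sym.
Qed.

Lemma parts_inj (n : nat) : injective (@parts n).
Proof. by move=> c d /(inj_map val_inj) /val_inj. Qed.

Lemma size_parts (n : nat) (c : bounded_seq n) : (size (parts c) <= n)%N.
Proof. by rewrite size_map size_bseq. Qed.

(** A list of sum [n] has entries at most [n], so only its length has to be
    checked. *)
Lemma parts_onto (n : nat) (s : seq nat) : (size s <= n)%N -> sumn s = n ->
  exists c : bounded_seq n, parts c = s.
Proof.
move=> sn sumsn.
have sn1 : (size [seq (inord k : 'I_n.+1) | k <- s] <= n)%N by rewrite size_map.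
exists (Bseq sn1); rewrite /parts /= -map_comp -[RHS]map_id.
apply/eq_in_map => k ks /=; rewrite inordK // ltnS -sumsn.
by rewrite sumnE (big_rem k) //= leq_addr.
Qed.

(** * Reinhardt polynomials as differences of antiperiodic binary sequences *)

Lemma exponents_widen (n : nat) (F : {poly int}) : (size F <= n)%N ->
  exponents F = [seq i <- iota 0 n | F`_i != 0].
Proof.
move=> Fn; rewrite -(subnKC Fn) iotaD filter_cat add0n -[LHS]cats0; congr (_ ++ _).
apply/esym/eqP; rewrite -[_ == _]negbK -has_filter; apply/hasPn => i.
by rewrite mem_iota => /andP[Fi _]; rewrite nth_default ?eqxx.
Qed.

Lemma nonzero_coefs_exponents (F : {poly int}) :
  nonzero_coefs F = [seq F`_i | i <- exponents F].
Proof. by rewrite /nonzero_coefs -{1}(mkseq_nth 0 F) /mkseq filter_map. Qed.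

Definition antiperiodic (n : nat) (b : nat -> bool) := forall i, b (i + n)%N = ~~ b i.

Definition changes (b : nat -> bool) (s : seq nat) := [seq i <- s | b i.+1 != b i].

Definition diff_poly (n : nat) (b : nat -> bool) : {poly int} :=
  \poly_(i < n) ((b i.+1 : nat)%:Z - (b i : nat)%:Z).

Lemma coef_diff_poly_neq0 (n : nat) (b : nat -> bool) (i : nat) : (i < n)%N ->
  ((diff_poly n b)`_i != 0) = (b i.+1 != b i).
Proof. by move=> i_n; rewrite coef_poly i_n; case: (b i.+1); case: (b i). Qed.

Lemma exponents_diff_poly (n : nat) (b : nat -> bool) :
  exponents (diff_poly n b) = changes b (iota 0 n).
Proof.
rewrite (exponents_widen (size_poly _ _)); apply: eq_in_filter => i.
by rewrite mem_iota => /andP[_ i_n]; rewrite coef_diff_poly_neq0.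
Qed.

(** This makes the number of nonzero coefficients odd, as [b n = ~~ b 0]. *)
Lemma odd_changes (b : nat -> bool) (m k : nat) :
  odd (size (changes b (iota m k))) = b m (+) b (m + k)%N.
Proof.
elim: k m => [|k IHk] m; first by rewrite addn0 addbb.
by rewrite /= -addSnnS; case: eqP => [<-|] /=; rewrite IHk //;
  case: (b m.+1); case: (b m); case: (b _).
Qed.

(** A step up must be followed by a step down. The initial sign in the path
    records the last step before [m], which leads to the value [b m]. *)
Lemma alternating_changes (b : nat -> bool) (m k : nat) :
  path (fun x y => y == - x) ((-1) ^+ (~~ b m) : int)
    [seq (b i.+1 : nat)%:Z - (b i : nat)%:Z | i <- changes b (iota m k)].
Proof.
rewrite /changes; elim: k m => //= k IHk m; have := IHk m.+1.
by case Bm1: (b m.+1); case Bm: (b m); rewrite /= ?Bm ?Bm1 ?subr0 ?sub0r ?expr0 ?expr1.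
Qed.

Lemma changes_inj (n : nat) (b b' : nat -> bool) : b 0%N = b' 0%N ->
  changes b (iota 0 n) = changes b' (iota 0 n) -> {in gtn n, b =1 b'}.
Proof.
move=> b0 bb'; elim=> // i IHi; rewrite !inE => i_n.
have := congr1 (fun s => i \in s) bb'; rewrite !mem_filter mem_iota /= (ltnW i_n) !andbT.
have := IHi (ltnW i_n).
by case: (b i.+1); case: (b' i.+1); case: (b i); case: (b' i).
Qed.

Lemma pairmap_subnK (x : nat) (s : seq nat) : path leq x s ->
  scanl addn x (pairmap (fun a b => b - a)%N x s) = s.
Proof. by elim: s x => //= y s IHs x /andP[xy ys]; rewrite subnKC // IHs. Qed.

Lemma sumn_pairmap_subn (x : nat) (s : seq nat) : path leq x s ->
  (x + sumn (pairmap (fun a b => b - a) x s) = last x s)%N.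
Proof.
elim: s x => /= [|y s IHs] x; rewrite ?addn0 // => /andP[xy ys].
by rewrite addnA subnKC // IHs.
Qed.

Lemma size_poly_composition (n : nat) (F : {poly int}) :
  size (poly_composition n F) = size (nonzero_coefs F).
Proof.
rewrite nonzero_coefs_exponents size_map /poly_composition.
by case: (exponents F) => // k ks; rewrite size_pairmap size_rcons.
Qed.

Lemma exponents_path (n : nat) (F : {poly int}) k ks : (size F <= n)%N ->
  exponents F = k :: ks -> path leq k (rcons ks (n + k)).
Proof.
move=> Fn Fk; rewrite rcons_path.
have : sorted leq (exponents F) by rewrite sorted_filter ?iota_sorted //; exact: leq_trans.
rewrite Fk /= => -> /=; have : last k ks \in exponents F by rewrite Fk mem_last.
rewrite mem_filter mem_iota /= add0n => /andP[_ lF].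
by rewrite (leq_trans (ltnW lF)) // (leq_trans Fn) ?leq_addr.
Qed.

Lemma sumn_poly_composition (n : nat) (F : {poly int}) : (size F <= n)%N ->
  exponents F != [::] -> sumn (poly_composition n F) = n.
Proof.
move=> Fn; rewrite /poly_composition; case Fk : (exponents F) => [//|k ks] _.
apply/eqP; rewrite -(eqn_add2l k) sumn_pairmap_subn ?last_rcons 1?addnC //.
by rewrite addnC; exact: exponents_path Fn Fk.
Qed.

(** The exponents are the partial sums of the gaps, starting from the least
    exponent. *)
Lemma poly_composition_inj (n : nat) (F G : {poly int}) :
  (size F <= n)%N -> (size G <= n)%N ->
  exponents F != [::] -> exponents G != [::] ->
  head 0%N (exponents F) = head 0%N (exponents G) ->
  poly_composition n F = poly_composition n G -> exponents F = exponents G.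
Proof.
rewrite /poly_composition => Fn Gn.
case Fk : (exponents F) => [//|k ks]; case Gk : (exponents G) => [//|l ls] _ _ /= kl.
rewrite -{l}kl in Gk * => /(congr1 (scanl addn k)).
rewrite (pairmap_subnK (exponents_path Fn Fk)) (pairmap_subnK (exponents_path Gn Gk)).
by move=> /rcons_inj[->].
Qed.

(** Divisibility over the integers, where it is taken up to constants, is
    divisibility over the rationals, and the cyclotomic polynomial is the minimal
    polynomial of [z]. *)
Lemma Cyclotomic_dvd_root (m : nat) (z : algC) (F : {poly int}) :
  m.-primitive_root z -> ('Phi_m %| F) = root (map_poly intr F) z.
Proof.
move=> zm; rewrite -dvdp_rat_int; have [P [minP _] dvdP] := minCpolyP z.
have ratr_intr (G : {poly int}) :
    map_poly ratr (map_poly intr G : {poly rat}) = map_poly intr G :> {poly algC}.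
  by rewrite -map_poly_comp; apply: eq_map_poly => x /=; rewrite ratr_int.
suff -> : map_poly intr 'Phi_m = P by rewrite -dvdP ratr_intr.
apply: (@map_poly_inj _ _ (ratr : {rmorphism rat -> algC})).
by rewrite -minP (minCpoly_cyclotomic zm) -(Cintr_Cyclotomic zm) ratr_intr.
Qed.

Lemma sum_blocks (V : zmodType) (g : nat -> V) (m r : nat) :
  \sum_(i < m * r) g i = \sum_(j < m) \sum_(t < r) g (t + r * j)%N.
Proof.
elim: m => [|m IHm]; first by rewrite mul0n !big_ord0.
rewrite big_ord_recr /= -IHm mulSn addnC big_split_ord /=; congr (_ + _).
by apply: eq_bigr => t _; rewrite addnC mulnC.
Qed.

(** Up to the factor [\sum_(j < q) g j], the sum is the geometric series
    [1 + u + ... + u ^ (p - 1)]. *)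
Lemma sum_quasiperiodic_eq0 (F : fieldType) (g : nat -> F) (u : F) (p q : nat) :
  u != 1 -> u ^+ p = 1 -> (forall j, g (j + q)%N = u * g j) ->
  \sum_(j < p * q) g j = 0.
Proof.
move=> u1 up gq; have gqk k j : g (j + q * k)%N = u ^+ k * g j.
  elim: k => [|k IHk]; first by rewrite muln0 addn0 mul1r.
  by rewrite mulnS addnCA addnC gq IHk exprS mulrA.
rewrite sum_blocks (eq_bigr (fun k : 'I_p => u ^+ k * \sum_(t < q) g t)); last first.
  by move=> k _; rewrite mulr_sumr; apply: eq_bigr => t _; rewrite gqk.
rewrite -mulr_suml; suff -> : \sum_(k < p) u ^+ k = 0 by rewrite mul0r.
have := subrX1 u p; rewrite up subrr => /esym/eqP.
by rewrite mulf_eq0 subr_eq0 (negbTE u1) => /eqP.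
Qed.

Lemma prim_root_half (F : fieldType) (n : nat) (z : F) : (0 < n)%N ->
  (2 * n).-primitive_root z -> z ^+ n = -1.
Proof.
move=> n0 zn; have := prim_expr_order zn; rewrite mulnC exprM => /eqP.
rewrite sqrf_eq1 => /orP[|/eqP //]; rewrite -(prim_order_dvd zn) => /dvdn_leq -/(_ n0).
by rewrite -{2}(mul1n n) leq_pmul2r.
Qed.

(** With [S i = (-1) ^ b i], the coefficients are [(S i - S (i + 1)) / 2], so
    that [2 * z * F(z)] is [(z - 1)] times the sum of the [S i * z ^ i] over
    a window of length [n]; the boundary terms cancel since
    [S (i + n) = - S i] and [z ^ n = -1]. *)
Lemma reinhardt_diff_poly (n : nat) (b : nat -> bool) (z : algC) : (0 < n)%N ->
  (2 * n).-primitive_root z -> antiperiodic n b ->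
  \sum_(i < n) (-1) ^+ b i * z ^+ i = 0 -> reinhardt_poly n (diff_poly n b).
Proof.
move=> n0 zn bn sum0; have nc : nonzero_coefs (diff_poly n b) =
    [seq (b i.+1 : nat)%:Z - (b i : nat)%:Z | i <- changes b (iota 0 n)].
  rewrite nonzero_coefs_exponents exponents_diff_poly; apply/eq_in_map => i.
  by rewrite mem_filter mem_iota /= coef_poly => /andP[_ ->].
apply/and5P; split.
- exact: size_poly.
- apply/(all_nthP 0) => i _; rewrite coef_poly !inE; case: ifP => // _.
  by case: (b i.+1); case: (b i).
- by rewrite nc; apply: path_sorted (alternating_changes b 0 n).
- by rewrite nc size_map odd_changes bn; case: (b 0%N).
rewrite (Cyclotomic_dvd_root _ zn) /root.
have z0 : z != 0.
  have := prim_root_half n0 zn; apply: contra_eq_neq => ->.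
  by rewrite expr0n gtn_eqF // eq_sym oppr_eq0 oner_eq0.
pose h i : algC := (-1) ^+ b i * z ^+ i.
have hn : h n = h 0%N.
  have bn0 : b n = ~~ b 0%N := bn 0%N.
  by rewrite /h (prim_root_half n0 zn) bn0; case: (b 0%N); rewrite /= ?expr0 ?expr1; ring.
(* Shifting the window by one changes the sum by [h n - h 0 = 0]. *)
have sumS : \sum_(i < n) h i.+1 = 0.
  apply: (addrI (h 0%N)); rewrite -(big_ord_recl n h) big_ord_recr /= hn addrC.
  by rewrite [X in _ + X]sum0.
rewrite /diff_poly; have -> : map_poly intr (diff_poly n b) =
    \poly_(i < n) ((b i.+1)%:R - (b i)%:R) :> {poly algC}.
  apply/polyP => i; rewrite coef_map !coef_poly; case: ifP => // _.
  by rewrite /= intrB.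
rewrite horner_poly -(mulrI_eq0 _ (mulfI (_ : 2 * z != 0))); last first.
  by rewrite mulf_neq0 // pnatr_eq0.
rewrite mulr_sumr (eq_bigr (fun i : 'I_n => z * h i - h i.+1)).
  by rewrite sumrB sumS -mulr_sumr [X in z * X]sum0 mulr0 subr0.
move=> i _; rewrite /h exprS.
by case: (b i.+1); case: (b i); rewrite /= ?expr0 ?expr1; ring.
Qed.

(** On the class of [t], translation by [r * q] multiplies the summand by
    [u = - z ^ (r * q)], where [u ^ p = - z ^ n = 1] as [p] is odd, and
    [u != 1] because [z] has order [2 * n > 2 * r * q]; likewise with
    [p] and [q] exchanged. *)
Lemma reinhardt_class_periodic (p q r : nat) (b : nat -> bool) :
  (1 < p)%N -> odd p -> (1 < q)%N -> odd q -> (0 < r)%N ->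
  antiperiodic (p * q * r) b ->
  (forall t, (t < r)%N -> (forall j, b (t + r * (j + q))%N = ~~ b (t + r * j)%N)
                       \/ (forall j, b (t + r * (j + p))%N = ~~ b (t + r * j)%N)) ->
  reinhardt_poly (p * q * r) (diff_poly (p * q * r) b).
Proof.
move=> p1 po q1 qo r0 bn bt; have n0 : (0 < p * q * r)%N.
  by rewrite !muln_gt0 r0 (ltnW p1) (ltnW q1).
have [|z zn] := @C_prim_root_exists (2 * (p * q * r)); first by rewrite muln_gt0.
apply: (reinhardt_diff_poly n0 zn bn).
rewrite (sum_blocks (fun i => (-1) ^+ b i * z ^+ i)) exchange_big big1 //= => t _.
have vanish p' q' : (1 < p')%N -> odd p' -> (0 < q')%N -> (p' * q' = p * q)%N ->
    (forall j, b (t + r * (j + q'))%N = ~~ b (t + r * j)%N) ->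
    \sum_(j < p * q) (-1) ^+ b (t + r * j)%N * z ^+ (t + r * j) = 0.
  move=> p'1 p'o q'0 pq bq; rewrite -pq; pose u := - z ^+ (r * q').
  apply: (@sum_quasiperiodic_eq0 _ (fun j => (-1) ^+ b (t + r * j)%N * z ^+ (t + r * j)) u).
  - rewrite /u eqr_oppLR; apply: contraTneq isT => zq.
    have : z ^+ (2 * (r * q')) = 1 by rewrite mulnC exprM zq sqrrN expr1n.
    move/eqP; rewrite -(prim_order_dvd zn) => /dvdn_leq.
    rewrite !muln_gt0 r0 q'0 => /(_ isT); rewrite leq_pmul2l // -pq -mulnA (mulnC q') leqNgt.
    by rewrite ltn_Pmull // muln_gt0 r0.
  - rewrite /u exprNn -exprM -signr_odd p'o expr1.
    have -> : (r * q' * p' = p * q * r)%N by rewrite -pq; ring.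
    by rewrite (prim_root_half n0 zn) mulrNN mulr1.
  - move=> j; rewrite bq mulnDr addnA exprD /u signrN; ring.
case: (bt t (ltn_ord t)); first exact: vanish p1 po (ltnW q1) erefl.
exact: vanish q1 qo (ltnW p1) (mulnC q p).
Qed.

(** * Many Reinhardt polygons *)

Local Notation block_code q r := {ffun 'I_r -> option {ffun 'I_q -> bool}}.

(** [i %% r] is the residue class and [i %/ r] the position within it. After the
    alternating factor is removed, the class of [t] carries a sequence of period
    [q] if [f t = Some w], and the indicator of the multiples of [p], of period
    [p], if [f t = None]. *)
Definition mixed (p q r : nat) (q0 : (0 < q)%N) (r0 : (0 < r)%N)
    (f : block_code q r) (i : nat) : bool :=
  odd (i %/ r) (+)
  (if f (Ordinal (ltn_pmod i r0)) is Some w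
   then w (Ordinal (ltn_pmod (i %/ r) q0)) else (p %| i %/ r)%N).

Lemma mixedE p q r (q0 : (0 < q)%N) (r0 : (0 < r)%N) (f : block_code q r) (t : 'I_r) j :
  mixed p q0 r0 f (t + r * j)%N =
  odd j (+) (if f t is Some w then w (Ordinal (ltn_pmod j q0)) else (p %| j)%N).
Proof.
have dj : ((t + r * j) %/ r = j)%N.
  by rewrite addnC mulnC divnMDl // divn_small // addn0.
rewrite /mixed dj; congr (odd j (+) _).
have -> : Ordinal (ltn_pmod (t + r * j) r0) = t.
  by apply: val_inj; rewrite /= addnC mulnC modnMDl modn_small.
by [].
Qed.

Lemma mixed_class p q r (q0 : (0 < q)%N) (r0 : (0 < r)%N) (f : block_code q r)
    (t : 'I_r) :
  odd p -> odd q ->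
  if f t is Some _ then
    forall j, mixed p q0 r0 f (t + r * (j + q)) = ~~ mixed p q0 r0 f (t + r * j)
  else
    forall j, mixed p q0 r0 f (t + r * (j + p)) = ~~ mixed p q0 r0 f (t + r * j).
Proof.
move=> po qo; case ft : (f t) => [w|] j; rewrite !mixedE ft oddD ?po ?qo addbT.
  by rewrite addNb; congr (~~ (_ (+) w _)); apply: val_inj; rewrite /= modnDr.
by rewrite addNb dvdn_addl.
Qed.

Lemma reinhardt_mixed p q r (q0 : (0 < q)%N) (r0 : (0 < r)%N) (f : block_code q r) :
  (1 < p)%N -> odd p -> (1 < q)%N -> odd q ->
  reinhardt_poly (p * q * r) (diff_poly (p * q * r) (mixed p q0 r0 f)).
Proof.
move=> p1 po q1 qo; have bn : antiperiodic (p * q * r) (mixed p q0 r0 f).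
  move=> i; have [t [j ->]] : exists (t : 'I_r) j, i = (t + r * j)%N.
    by exists (Ordinal (ltn_pmod i r0)), (i %/ r)%N; rewrite /= addnC mulnC -divn_eq.
  rewrite -addnA (mulnC _ r) -mulnDr !mixedE oddD oddM po qo addbT addNb.
  case: (f t) => [w|]; last by rewrite dvdn_addl // dvdn_mulr.
  by congr (~~ (_ (+) w _)); apply: val_inj; rewrite /= addnC modnMDl.
apply: reinhardt_class_periodic => // t tr.
have := @mixed_class p q r q0 r0 f (Ordinal tr) po qo.
by case: (f _) => [w|] h; [left | right].
Qed.

(** The indicator of the multiples of [p] takes different values at 0 and at
    [q], so that it does not have period [q]; the other codes of a class are
    told apart by the positions below [q]. *)
Lemma mixed_inj p q r (q0 : (0 < q)%N) (r0 : (0 < r)%N) (f : block_code q r) g :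
  (1 < p)%N -> coprime p q ->
  {in gtn (p * q * r)%N, mixed p q0 r0 f =1 mixed p q0 r0 g} -> f = g.
Proof.
move=> p1 pq fg; apply/ffunP => t.
have bound j : (j <= q)%N -> (t + r * j < p * q * r)%N.
  move=> jq; apply: (@leq_trans (r * j.+1)).
    by rewrite mulnS ltn_add2r.
  by rewrite mulnC leq_mul2r; apply/orP; right; nia.
have {fg} eqj j : (j <= q)%N ->
   (if f t is Some w then w (Ordinal (ltn_pmod j q0)) else (p %| j)%N) =
   (if g t is Some w then w (Ordinal (ltn_pmod j q0)) else (p %| j)%N).
  by move=> jq; have := fg _ (bound j jq); rewrite !mixedE => /addbI.
have npq : (p %| q)%N = false.
  apply: contraTF pq => pq; rewrite /coprime (gcdn_idPl pq).
  by rewrite gtn_eqF.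
have q_0 : Ordinal (ltn_pmod q q0) = Ordinal (ltn_pmod 0 q0).
  by apply: val_inj; rewrite /= modnn mod0n.
have := eqj q (leqnn q); have := eqj 0%N (leq0n q).
case ft : (f t) eqj => [w|]; case gt : (g t) => [w'|] eqj //.
- move=> _ _; congr Some; apply/ffunP => y.
  have := eqj y (ltnW (ltn_ord y)).
  have -> // : Ordinal (ltn_pmod y q0) = y.
  by apply: val_inj; rewrite /= modn_small.
- by rewrite q_0 npq dvdn0 => ->.
- by rewrite q_0 npq dvdn0 => <-.
Qed.

(** A sequence can be recovered from its dihedral class together with a rotation
    and a reflection leading from a fixed representative of that class to the
    composition, the least exponent, and the first value. *)
Lemma card_le_reinhardt (T : finType) (n : nat) (b : T -> nat -> bool) :
  (0 < n)%N ->
  (forall f, reinhardt_poly n (diff_poly n (b f))) ->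
  (forall f g, {in gtn n, b f =1 b g} -> f = g) ->
  (#|T| <= 4 * n ^ 2 * (E0 n + E1 n))%N.
Proof.
move=> n0 bR binj; pose F f := diff_poly n (b f).
have Fn f : (size (F f) <= n)%N by exact: size_poly.
have ex0 f : exponents (F f) != [::].
  have /and5P[_ _ _ + _] := bR f; rewrite nonzero_coefs_exponents size_map.
  by apply: contraTneq => ->.
have headn f : (head 0 (exponents (F f)) < n)%N.
  have := ex0 f; case Ff : (exponents (F f)) => [//|k ks] _ /=.
  have : k \in exponents (F f) by rewrite Ff mem_head.
  by rewrite mem_filter mem_iota => /and3P[_ _ kF]; apply: leq_trans kF (Fn f).
have compP f : exists c : bounded_seq n, parts c = poly_composition n (F f).
  apply: parts_onto; last exact: sumn_poly_composition.
  rewrite size_poly_composition nonzero_coefs_exponents size_map.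
  rewrite exponents_diff_poly size_filter -[leqRHS](size_iota 0); exact: count_size.
have [c cE] := choice compP.
pose rep (P : {set bounded_seq n}) := oapp (@parts n) [::] [pick d in P].
pose D : finType := (({set bounded_seq n} * 'I_n) * (bool * 'I_n * bool))%type.
have dataP f : exists x : D,
    [/\ x.1.1 = dihedral_class (c f),
        poly_composition n (F f) =
          rot x.1.2 (if x.2.1.1 then rev (rep x.1.1) else rep x.1.1),
        head 0%N (exponents (F f)) = x.2.1.2 & b f 0%N = x.2.2].
  have cc : c f \in dihedral_class (c f).
    by apply/mem_dihedral_class; exact: dihedral_eq_refl.
  have : dihedral_eq (rep (dihedral_class (c f))) (parts (c f)) /\
         (size (rep (dihedral_class (c f))) <= n)%N.
    rewrite /rep; case: pickP => [d /mem_dihedral_class|/(_ (c f))]; last by rewrite cc.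
    by move=> /dihedral_eq_sym ? /=; split=> //; exact: size_parts.
  case=> h hn; have [i [e ce]] := dihedral_eq_bounded n0 hn h.
  by exists (dihedral_class (c f), i, (e, Ordinal (headn f), b f 0%N)); rewrite -cE.
have [x xP] := choice dataP.
have x_inj : injective x.
  move=> f g fg; apply: binj; have [_ fc fh f0] := xP f; have [_ gc gh g0] := xP g.
  apply: changes_inj; first by rewrite f0 g0 fg.
  rewrite -!exponents_diff_poly -!/(F _).
  apply: (@poly_composition_inj n) => //; first by rewrite fh gh fg.
  by rewrite fc gc fg.
have EE : (E0 n + E1 n = #|reinhardt_polygons n|)%N.
  rewrite -(cardsID [set P : {set bounded_seq n} | Defs.periodic P]).
  by congr (_ + _)%N; apply: eq_card => P; rewrite !inE // andbC.
rewrite EE -cardsT -(card_imset _ x_inj).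
apply: (@leq_trans #|finset.setX (finset.setX (reinhardt_polygons n) [set: 'I_n])
                              [set: bool * 'I_n * bool]|).
  apply/subset_leq_card/fintype.subsetP => _ /imsetP[f _ ->].
  have [xc _ _ _] := xP f; rewrite !inE !andbT xc.
  apply/imsetP; exists (c f) => //; rewrite inE; apply/asboolP.
  by exists (F f); [exact: bR | rewrite cE].
rewrite !cardsX !cardsT !card_prod card_ord card_bool; nia.
Qed.

(** * Few periodic Reinhardt polygons *)

(** All members of a class have as many parts as the polynomial has nonzero
    coefficients. *)
Lemma mem_reinhardt_odd_size (n : nat) (P : {set bounded_seq n}) (c : bounded_seq n) :
  P \in reinhardt_polygons n -> c \in P -> odd (size (parts c)) /\ P = dihedral_class c.
Proof.
case/imsetP => d; rewrite inE => /asboolP[F FR Fd] -> /mem_dihedral_class dc.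
split; last exact: dihedral_class_eq.
rewrite -(dihedral_eq_size dc) -Fd size_poly_composition.
by case/and5P: FR.
Qed.

(** A composition of a number up to [L] is encoded by the set of its partial sums,
    starting with 0: they form a strictly increasing list, which its set of members
    determines. *)
Lemma scanl_addn_inj (L : nat) (d e : seq nat) :
  all (leq 1) d -> all (leq 1) e -> (sumn d <= L)%N -> (sumn e <= L)%N ->
  [set x : 'I_L.+1 | val x \in scanl addn 0%N d] =
  [set x : 'I_L.+1 | val x \in scanl addn 0%N e] -> d = e.
Proof.
have props (s : seq nat) x : all (leq 1) s ->
    path ltn x (scanl addn x s) /\
    (forall y, y \in scanl addn x s -> (y <= x + sumn s)%N).
  elim: s x => //= k s IHs x /andP[k0 /(IHs (x + k)%N)[xs sums]].
  split; first by rewrite -{1}(addn0 x) ltn_add2l k0.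
  move=> y; rewrite inE addnA => /orP[/eqP ->|/sums //].
  exact: leq_addr.
move=> /(props _ 0%N)[d_lt dL] /(props _ 0%N)[e_lt eL] dn en de.
have addnK' x : cancel (addn x) (fun y => y - x)%N by move=> y; rewrite addKn.
rewrite -[d](scanlK addnK' 0%N) -[e](scanlK addnK' 0%N); congr pairmap.
apply: (irr_sorted_eq ltn_trans ltnn (path_sorted d_lt) (path_sorted e_lt)).
have mem_iff x : (x <= L)%N -> (x \in scanl addn 0%N d) = (x \in scanl addn 0%N e).
  move=> xL; have := congr1 (fun A : {set 'I_L.+1} => inord x \in A) de.
  by rewrite !inE /= inordK.
move=> x; apply/idP/idP => xs; have xs' := xs.
  by rewrite -mem_iff // (leq_trans (dL _ xs)).
by rewrite mem_iff // (leq_trans (eL _ xs)).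
Qed.

(** The number of repetitions is odd because the total number of parts is, and so
    it has an odd prime factor, which is at least [p]. The repeated
    composition, of a number [m <= n / p], determines the class. *)
Lemma E0_le (n p : nat) : (0 < n)%N -> (0 < p)%N ->
  (forall p', prime p' -> odd p' -> p' %| n -> p <= p')%N ->
  (E0 n <= 2 ^ (n %/ p).+1)%N.
Proof.
move=> n0 p0 pmin; set L := (n %/ p)%N.
pose A := [set P in reinhardt_polygons n | Defs.periodic P].
have codeP (P : {set bounded_seq n}) : exists x : {set 'I_L.+1}, P \in A ->
    exists c d, [/\ P = dihedral_class c, all (leq 1) d, (sumn d <= L)%N,
      parts c = flatten (nseq (n %/ sumn d) d) &
      x = [set y : 'I_L.+1 | val y \in scanl addn 0%N d]].
  case: (boolP (P \in A)) => [|_]; last by exists finset.set0.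
  rewrite inE => /andP[PR /existsP[c /andP[cP /asboolP]]].
  move=> [m [d [mn m_n /andP[d1 /eqP dm] dodd cE]]].
  have [codd Pc] := mem_reinhardt_odd_size PR cP.
  exists [set y : 'I_L.+1 | val y \in scanl addn 0%N d] => _.
  exists c, d; split=> //; rewrite ?dm //.
  have m0 := dvdn_gt0 n0 mn.
  have k_odd : odd (n %/ m).
    move: codd; rewrite cE size_flatten /shape map_nseq sumn_nseq oddM.
    by case/andP.
  have k1 : (1 < n %/ m)%N. by rewrite ltn_divRL // mul1n.
  have pk : (p <= n %/ m)%N.
    apply: leq_trans (pdiv_leq (ltnW k1)); apply: pmin.
    - exact: pdiv_prime.
    - exact: dvdn_odd (pdiv_dvd _) k_odd.
    - exact: dvdn_trans (pdiv_dvd _) (dvdn_div mn).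
  by rewrite leq_divRL // -(divnK mn) mulnC leq_mul2r pk orbT.
have [x xP] := choice codeP.
have xinj : {in A &, injective x}.
  move=> P Q /xP[c [d [-> d1 dL cE ->]]] /xP[c' [d' [-> d'1 d'L c'E ->]]].
  move/(scanl_addn_inj d1 d'1 dL d'L) => dd'.
  by congr dihedral_class; apply: parts_inj; rewrite cE c'E dd'.
have := leq_card_in x (mem A) xinj.
by rewrite -cardsT -powersetT card_powerset cardsT card_ord.
Qed.

(** For large [n] the number [E0 n + E1 n] of all Reinhardt polygons exceeds twice
    the upper bound on [E0 n]. *)
Lemma sporadic_dominate (K : nat) : exists n0, forall n, (n0 <= n)%N ->
  (exists p q, two_small_odd_primes K n p q) -> (E0 n < E1 n)%N.
Proof.
have [n0 Hn0] := mixed_count_dominates K; exists n0.+1 => n nn0 [p [q [pP qP pqK pmin]]].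
have /and3P[pp po pn] := pP; have /and3P[qp qo qn] := qP; have /andP[pq _] := pqK.
have cpq : coprime p q.
  by rewrite prime_coprime // dvdn_prime2 // ltn_eqF.
have /dvdnP[r nE] : (p * q %| n)%N by rewrite Gauss_dvd // pn.
rewrite mulnC in nE; have npos : (0 < n)%N by exact: leq_ltn_trans nn0.
have r0 : (0 < r)%N by move: npos; rewrite nE muln_gt0 => /andP[].
have p1 := prime_gt1 pp; have q1 := prime_gt1 qp; have q0 := ltnW q1.
have /= := @card_le_reinhardt (block_code q r) n (@mixed p q r q0 r0) npos.
have nq : (n %/ p = q * r)%N by rewrite nE -mulnA mulKn // ltnW.
have := E0_le npos (ltnW p1) pmin; rewrite nq => E0le.
have big := Hn0 _ _ _ _ (ltnW nn0) nE pqK.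
rewrite card_ffun card_option card_ffun card_bool !card_ord nE.
move=> /(_ (fun f => reinhardt_mixed q0 r0 f p1 po q1 qo)).
move=> /(_ (fun f g => @mixed_inj p q r q0 r0 f g p1 cpq)); rewrite -nE => le1.
rewrite ltnNge; apply/negP => E10.
have : (4 * n ^ 2 * (E0 n + E1 n) <= 16 * n ^ 2 * 2 ^ (q * r))%N.
  have -> : (16 * n ^ 2 * 2 ^ (q * r) = 4 * n ^ 2 * (2 * (2 ^ (q * r).+1)))%N.
    by rewrite (expnS 2 (q * r)); ring.
  by rewrite leq_mul2l mul2n -addnn leq_add ?orbT // (leq_trans E10).
by move/(leq_trans le1); rewrite leqNgt big.
Qed.

Theorem theorem1p1 (R : realType) :
  has_natural_density (fun n : nat => (E0 n < E1 n)%N) (1 : R).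
Proof.
apply: density_one => K; exact: sporadic_dominate.
Qed.
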